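(* Let $1\le l_1\le a_1$ be integers and let $\mathbf z^{(1)}_1,\dots,\mathbf z^{(1)}_{a_1}\in\mathbb{R}^{l_1}$ be a latent parameterization of a single qualitative factor with $a_1$ levels, such that the $l_1\times l_1$ matrix $\big(\mathbf z^{(1)}_1,\dots,\mathbf z^{(1)}_{l_1}\big)$ has full rank and $\|\mathbf z^{(1)}_v\|_2=1$ for all $1\le v\le a_1$. (a) There exists a unique latent parameterization $\mathbf w^{(1)}_1,\dots,\mathbf w^{(1)}_{a_1}\in\mathbb{R}^{l_1}$, with coordinates $\mathbf w^{(1)}_v=(w^{(1)}_{v,1},\dots,w^{(1)}_{v,l_1})^\top$, satisfying $w^{(1)}_{v,l}=0$ for all $l>v$ and $w^{(1)}_{v,v}>0$ for $1\le v\le l_1$, that is equivalent to $\mathbf z^{(1)}_1,\dots,\mathbf z^{(1)}_{a_1}$ under the linear kernel. (b) Suppose $l_1\ge 2$. The parameterization $\mathbf w^{(1)}_1,\dots,\mathbf w^{(1)}_{a_1}$ of (a) can be expressed in hyperspherical coordinates: there exist angles $\theta^{(1)}_{v,l}$, $1\le v\le a_1$, $1\le l\le l_1-1$, such that for every $v\in\{1,\dots,a_1\}$ $$w^{(1)}_{v,l}=\cos\big(\theta^{(1)}_{v,l}\big)\prod_{\iota=1}^{l-1}\sin\big(\theta^{(1)}_{v,\iota}\big)\ \text{ for }1\le l\le l_1-1,\qquad w^{(1)}_{v,l_1}=\prod_{\iota=1}^{l_1-1}\sin\big(\theta^{(1)}_{v,\iota}\big),$$ and the angles satisfy the constraints: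 $0\le\theta^{(1)}_{v,l_1-1}\le 2\pi$ for $v\ge l_1$; $0\le\theta^{(1)}_{v,l}\le\pi$ for all other pairs $(v,l)$ with $1\le l<\min(v,l_1)$; and $\theta^{(1)}_{v,l}=0$ for $v\le l$.
   Context: A latent parameterization of a single qualitative factor with levels $\{1,\dots,a_1\}$ assigns to each level $v$ a vector in $\mathbb{R}^{l_1}$. The linear kernel is $K(\mathbf x,\mathbf y)=\mathbf x^\top\mathbf y$. Two latent parameterizations $(\mathbf z^{(1)}_v)_{v=1}^{a_1}$ and $(\mathbf w^{(1)}_v)_{v=1}^{a_1}$ in $\mathbb{R}^{l_1}$ are equivalent under a kernel $K$ if $K(\mathbf z^{(1)}_v,\mathbf z^{(1)}_{v'})=K(\mathbf w^{(1)}_v,\mathbf w^{(1)}_{v'})$ for all $v,v'\in\{1,\dots,a_1\}$. Empty products equal $1$. *)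

(* Defs.v *)
From HB Require Import structures.
From mathcomp Require Import all_boot all_order all_algebra.
From mathcomp Require Import all_classical all_reals all_analysis.

Set Implicit Arguments.
Unset Strict Implicit.
Unset Printing Implicit Defensive.

Import Order.TTheory GRing.Theory Num.Theory.
Local Open Scope ring_scope.

(* Ordinals are 0-based: level [v : 'I_a] and coordinate [i : 'I_l] stand for
   the 1-based indices [v.+1] and [i.+1]. *)
Definition latent_param (R : realType) (a l : nat) : Type := 'I_a -> 'cV[R]_l.

Definition linear_kernel (R : realType) (l : nat) (x y : 'cV[R]_l) : R :=
  (x^T *m y) 0 0.

(* The library norm on matrices is the sup norm, so the Euclidean one is
   written out. *)
Definition norm2 (R : realType) (l : nat) (x : 'cV[R]_l) : R :=
  Num.sqrt (\sum_(i < l) x i 0 ^+ 2).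

Definition equivalent_under (R : realType) (a l : nat)
    (K : 'cV[R]_l -> 'cV[R]_l -> R) (z w : latent_param R a l) : Prop :=
  forall v v' : 'I_a, K (z v) (z v') = K (w v) (w v').

Definition leading_matrix (R : realType) (a l : nat) (hla : (l <= a)%N)
    (z : latent_param R a l) : 'M[R]_l :=
  \matrix_(i < l, j < l) z (widen_ord hla j) i 0.

Definition lower_triangular_pos (R : realType) (a l : nat) (hla : (l <= a)%N)
    (w : latent_param R a l) : Prop :=
  (forall (v : 'I_a) (i : 'I_l), (v < i)%N -> w v i 0 = 0) /\
  (forall i : 'I_l, 0 < w (widen_ord hla i) i 0).

(* A point of R^l has l - 1 angles.  The second clause is about the last
   coordinate, the only [i : 'I_l] with [i.+1 = l]. *)
Definition hyperspherical (R : realType) (l : nat)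
    (theta : 'I_l.-1 -> R) (x : 'cV[R]_l) : Prop :=
  (forall j : 'I_l.-1,
      x (widen_ord (leq_pred l) j) 0 =
      cos (theta j) * \prod_(k < l.-1 | (k < j)%N) sin (theta k)) /\
  (forall i : 'I_l, i.+1 = l -> x i 0 = \prod_(k < l.-1) sin (theta k)).

(* The successors restore the 1-based indices of the level and of the angle. *)
Definition angle_constraints (R : realType) (a l : nat)
    (theta : 'I_a -> 'I_l.-1 -> R) : Prop :=
  forall (v : 'I_a) (j : 'I_l.-1),
    [/\ (l <= v.+1)%N -> j.+1 = l.-1 -> 0 <= theta v j <= 2 * pi,
        (j.+1 < minn v.+1 l)%N -> ~ ((l <= v.+1)%N /\ j.+1 = l.-1) ->
          0 <= theta v j <= pi
      & (v.+1 <= j.+1)%N -> theta v j = 0].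

(* Main.v *)
(* If Z is the matrix of the first l1 levels, the Cholesky factorization
   Z^T Z = U^T U makes Q = U Z^-1 orthogonal, so w_v = Q z_v has the same Gram
   matrix as z, and w_1, ..., w_l1 are the columns of U.  For the angles of a
   unit vector x, let r_j be the Euclidean norm of (x_j, ..., x_n): then
   theta_j = acos (x_j / r_j), with theta_j = 0 when r_j = 0, satisfies
   r_(j+1) = r_j sin theta_j, and r_n = |x_n|.  A negative last coordinate is
   handled by reflecting the last angle. *)
Require Import Defs.
From HB Require Import structures.
From mathcomp Require Import all_boot all_order all_algebra.
From mathcomp Require Import all_classical all_reals all_analysis.
From mathcomp Require Import lra.

Set Implicit Arguments.
Unset Strict Implicit.
Unset Printing Implicit Defensive.

Import Order.TTheory GRing.Theory Num.Theory.
Local Open Scope ring_scope.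

(** * Cholesky factorization *)

(** Induction on the size: the Schur complement [S] of the top left entry [a] is again symmetric and
    positive definite, and a factor of [S], bordered by the row made of [s] and [s^-1 *: b] with [s]
    the square root of [a], is a factor of [G]. *)
Lemma cholesky (R : rcfType) (n : nat) (G : 'M[R]_n) :
    G^T = G ->
    (forall x : 'cV[R]_n, x != 0 -> 0 < (x^T *m G *m x) 0 0) ->
  exists U : 'M[R]_n,
    [/\ forall i j : 'I_n, (j < i)%N -> U i j = 0,
        forall i, 0 < U i i
      & U^T *m U = G].
Proof.
elim: n G => [|n IHn] G Gsym Gpos.
  by exists 0; split=> [[]|[]|] //; apply/matrixP=> -[].
change 'M[R]_(1 + n) in (type of G).
pose b : 'rV[R]_n := ursubmx G; pose C := drsubmx G; pose a := G 0 0.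
have GE : G = block_mx a%:M b b^T C.
  rewrite -{1}(submxK G) /b /C trmx_ursub Gsym; congr block_mx.
  by rewrite [LHS]mx11_scalar !mxE lshift0.
have a_gt0 : 0 < a.
  have e0 : delta_mx 0 0 != 0 :> 'cV[R]_n.+1.
    by apply/negP=> /eqP/matrixP/(_ 0 0); rewrite !mxE => /eqP; rewrite oner_eq0.
  by have := Gpos _ e0; rewrite trmx_delta -rowE -colE !mxE.
have a_neq0 : a != 0 by rewrite gt_eqF.
pose S := C - a^-1 *: (b^T *m b).
have Ssym : S^T = S.
  rewrite /S linearB /= linearZ /= trmx_mul trmxK; congr (_ - _).
  by rewrite /C trmx_drsub Gsym.
have Spos (x : 'cV[R]_n) : x != 0 -> 0 < (x^T *m S *m x) 0 0.
  (* The top entry of [y] is chosen to cancel the first entry of [G *m y], which leaves [S *m x]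
     below it. *)
  move=> x0; pose y : 'cV[R]_(1 + n) := col_mx (- a^-1 *: (b *m x)) x.
  have y0 : y != 0 by rewrite col_mx_eq0 negb_and x0 orbT.
  have := Gpos y y0; suff -> : y^T *m G *m y = x^T *m S *m x by [].
  rewrite GE -mulmxA mul_block_col tr_col_mx mul_row_col mul_scalar_mx scalerA.
  rewrite mulrN divff // scaleN1r addNr mulmx0 add0r -mulmxA; congr (_ *m _).
  by rewrite /S mulmxBl -scalemxAr -scalemxAl mulmxA scaleNr addrC.
have [U [Utri Upos UG]] := IHn _ Ssym Spos.
pose s := Num.sqrt a.
have s_gt0 : 0 < s by rewrite sqrtr_gt0.
have s_neq0 : s != 0 by rewrite gt_eqF.
have sE : s * s = a by rewrite -expr2 sqr_sqrtr // ltW.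
pose V : 'M[R]_(1 + n) := block_mx s%:M (s^-1 *: b) 0 U.
have VG : V^T *m V = G.
  rewrite tr_block_mx mulmx_block GE trmx0 tr_scalar_mx !mul0mx !mulmx0.
  rewrite !addr0 -scalar_mxM sE mul_scalar_mx scalerA divff // scale1r.
  rewrite mul_mx_scalar linearZ /= scalerA divff // scale1r UG.
  by rewrite -scalemxAl -scalemxAr scalerA -invfM sE /S addrC subrK.
exists V; split; last exact: VG.
- move=> i j; have [i' ->|i' ->] := @split_ordP 1 n i;
    have [j' ->|j' ->] := @split_ordP 1 n j.
  + by rewrite !ord1.
  + by rewrite ord1.
  + by move=> _; rewrite [LHS](@block_mxEdl R 1 n 1 n) mxE.
  + by rewrite /= !add1n ltnS => /Utri <-; exact: (@block_mxEdr R 1 n 1 n).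
- move=> i; have [i' ->|i' ->] := @split_ordP 1 n i.
  + by rewrite [ltRHS](@block_mxEul R 1 n 1 n) ord1 mxE eqxx.
  + by rewrite [ltRHS](@block_mxEdr R 1 n 1 n).
Qed.

(** * Gram matrices and triangular parameterizations *)

Lemma linear_kernelE (R : realType) (l : nat) (x y : 'cV[R]_l) :
  linear_kernel x y = \sum_(i < l) x i 0 * y i 0.
Proof. by rewrite /linear_kernel mxE; apply: eq_bigr => i _; rewrite mxE. Qed.

(** The form is the squared Euclidean norm of [Z *m x], and an invertible [Z] kills no nonzero
    vector. *)
Lemma gram_posdef (R : realType) (n : nat) (Z : 'M[R]_n) (x : 'cV[R]_n) :
  Z \in unitmx -> x != 0 -> 0 < (x^T *m (Z^T *m Z) *m x) 0 0.
Proof.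
move=> Zu x0; set y := Z *m x.
have y0 : y != 0.
  by apply: contraNneq x0 => y0; rewrite -(mulKmx Zu x) -/y y0 mulmx0.
rewrite !mulmxA -trmx_mul -mulmxA -/y -/(linear_kernel y y) linear_kernelE.
rewrite lt_neqAle sumr_ge0 ?andbT => [|i _]; last by rewrite -expr2 sqr_ge0.
apply: contra_neq y0 => /esym/eqP; rewrite psumr_eq0 => [/allP y0|i _].
  apply/colP=> i; rewrite [RHS]mxE; apply/eqP.
  by have := y0 i (mem_index_enum i); rewrite /= mulf_eq0 orbb.
by rewrite -expr2 sqr_ge0.
Qed.

Lemma triangular_param_exists (R : realType) (a l : nat) (hla : (l <= a)%N)
    (z : latent_param R a l) :
    leading_matrix hla z \in unitmx ->
  exists w : latent_param R a l,
    lower_triangular_pos hla w /\ equivalent_under (@linear_kernel R l) z w.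
Proof.
set Z := leading_matrix hla z => Zu.
have [|x|U [Utri Upos UG]] := @cholesky R l (Z^T *m Z).
- by rewrite trmx_mul trmxK.
- exact: gram_posdef.
pose Q := U *m invmx Z.
have QQ : Q^T *m Q = 1%:M.
  rewrite trmx_mul mulmxA -[_ *m U]mulmxA UG trmx_inv.
  by rewrite mulmxA mulVmx ?unitmx_tr // mul1mx mulmxV.
have QZ (j i : 'I_l) : (Q *m z (widen_ord hla j)) i 0 = U i j.
  have -> : z (widen_ord hla j) = col j Z by apply/colP=> k; rewrite !mxE.
  by rewrite colE mulmxA -colE mulmxKV // mxE.
exists (fun v => Q *m z v); split; first split.
(* Since [i] is below [l], so is [v]: the zero pattern only concerns the leading levels, whose
   images are the columns of [U]. *)
- move=> v i vi; have vl : (v < l)%N := ltn_trans vi (ltn_ord i).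
  have -> : v = widen_ord hla (Ordinal vl) by apply: val_inj.
  by rewrite QZ Utri.
- by move=> i; rewrite QZ.
by move=> v v'; rewrite /linear_kernel trmx_mul mulmxA -[_ *m Q]mulmxA QQ mulmx1.
Qed.

(* Comparing the inner products with level [i] determines the [i]-th
   coordinates once the previous ones are known. *)
Lemma triangular_param_unique (R : realType) (a l : nat) (hla : (l <= a)%N)
    (w w' : latent_param R a l) :
    lower_triangular_pos hla w -> lower_triangular_pos hla w' ->
    equivalent_under (@linear_kernel R l) w w' ->
  w = w'.
Proof.
move=> [w0 w_gt0] [w'0 w'_gt0] ww'.
(* The induction on the coordinate treats all levels at once, because the step for [v] also uses the
   earlier coordinates of level [i]. *)
suff E m (i : 'I_l) v : (i < m)%N -> w v i 0 = w' v i 0.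
  by apply/funext => v; apply/colP => i; apply: (E i.+1).
elim: m i v => // m IHm i v; rewrite ltnS leq_eqVlt => /orP[/eqP im|]; last exact: IHm.
have Ei u : w (widen_ord hla i) i 0 * w u i 0 = w' (widen_ord hla i) i 0 * w' u i 0.
  have := ww' (widen_ord hla i) u.
  rewrite !linear_kernelE (bigD1 i) //= [RHS](bigD1 i) //=.
  (* Terms with [k < i] agree by induction; those with [k > i] vanish because level [i] has no
     coordinate past the diagonal. *)
  rewrite (eq_bigr (fun k => w' (widen_ord hla i) k 0 * w' u k 0)); first exact: addIr.
  move=> k; rewrite -val_eqE neq_ltn => /orP[ki|ik]; first by rewrite !IHm // -im.
  have ik' : (widen_ord hla i < k)%N := ik.
  by rewrite (w0 _ _ ik') (w'0 _ _ ik') !mul0r.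
(* Pairing level [i] with itself equates two squares, and positivity of the diagonal removes the
   sign ambiguity. *)
have d : w (widen_ord hla i) i 0 = w' (widen_ord hla i) i 0.
  have := Ei (widen_ord hla i); rewrite -!expr2 => /eqP.
  by rewrite eqrXn2 ?ltW // => /eqP.
by have := Ei v; rewrite d => /mulfI; apply; rewrite gt_eqF.
Qed.

(** * Hyperspherical angles of a unit vector *)

(** A nonnegative last coordinate lets every angle lie in the range of [acos]. The last clause
    serves the levels whose coordinates vanish past the diagonal. *)
Lemma hyperspherical_angles_pos (R : realType) (n : nat) (x : nat -> R) :
    \sum_(0 <= i < n.+1) x i ^+ 2 = 1 -> 0 <= x n ->
  exists theta : nat -> R,
    [/\ forall j, (j < n)%N -> x j = cos (theta j) * \prod_(k < j) sin (theta k),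
        x n = \prod_(k < n) sin (theta k),
        forall j, 0 <= theta j <= pi
      & forall j, (j <= n)%N -> 0 <= x j ->
          (forall i, (j < i <= n)%N -> x i = 0) -> theta j = 0].
Proof.
move=> x_norm xn_ge0.
pose r j := Num.sqrt (\sum_(j <= i < n.+1) x i ^+ 2).
(* [r j] also vanishes for [j > n], where the sum is empty, so the default 0 keeps the range bound
   valid for every natural [j]. *)
pose theta j := if r j == 0 then 0 else acos (x j / r j).
have r_ge0 j : 0 <= r j by exact: sqrtr_ge0.
have r2 j : r j ^+ 2 = \sum_(j <= i < n.+1) x i ^+ 2.
  by rewrite sqr_sqrtr // sumr_ge0 // => i _; rewrite sqr_ge0.
have rS j : (j <= n)%N -> r j ^+ 2 = x j ^+ 2 + r j.+1 ^+ 2.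
  by move=> jn; rewrite !r2 big_ltn.
have r_tail j : (j <= n)%N -> (forall i, (j < i <= n)%N -> x i = 0) -> r j = `|x j|.
  move=> jn tail0; rewrite /r big_ltn // big_nat_cond big1 ?addr0 ?sqrtr_sqr //.
  by move=> i; rewrite andbT => /tail0 ->; rewrite expr0n.
have ratio j : (j <= n)%N -> r j != 0 -> -1 <= x j / r j <= 1.
  move=> jn rj0; rewrite -ler_norml -(@ler_pXn2r _ 2) ?nnegrE //.
  rewrite expr1n real_normK ?num_real // expr_div_n ler_pdivrMr ?mul1r; last first.
    by rewrite lt_neqAle sqr_ge0 eq_sym sqrf_eq0 rj0.
  by rewrite rS // lerDl sqr_ge0.
have cosE j : (j <= n)%N -> x j = cos (theta j) * r j.
  move=> jn; rewrite /theta; case: eqVneq => [rj0|rj0].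
    have := rS _ jn; rewrite rj0 expr0n => /esym/eqP.
    by rewrite paddr_eq0 ?sqr_ge0 // sqrf_eq0 => /andP[/eqP -> _]; rewrite mulr0.
  by rewrite acosK ?divfK // in_itv /= ratio.
have sinE j : (j <= n)%N -> r j.+1 = sin (theta j) * r j.
  move=> jn; have sin_ge0 : 0 <= sin (theta j).
    rewrite /theta; case: eqVneq => [_|rj0]; first by rewrite sin0.
    by rewrite sin_acos ?ratio ?sqrtr_ge0.
  (* Both sides are nonnegative, so it suffices to compare squares. *)
  apply/eqP; rewrite -(@eqrXn2 _ 2) ?mulr_ge0 // exprMn sin2cos2 mulrBl mul1r.
  by rewrite -exprMn -cosE // (rS j) // addrC addKr.
have prodE j : (j <= n)%N -> r j = \prod_(k < j) sin (theta k).
  elim: j => [_|j IHj jn]; first by rewrite big_ord0 /r x_norm sqrtr1.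
  by rewrite big_ord_recr /= -IHj 1?ltnW // mulrC sinE // ltnW.
exists theta; split.
- by move=> j jn; rewrite -prodE 1?ltnW // -cosE // ltnW.
- rewrite -prodE // r_tail // ?ger0_norm // => i /andP[ni i_n].
  by move: (leq_ltn_trans i_n ni); rewrite ltnn.
- move=> j; rewrite /theta; case: eqVneq => [_|rj0]; first by rewrite lexx pi_ge0.
  have [jn|nj] := leqP j n; first by rewrite acos_ge0 ?acos_lepi ?ratio.
  by move: rj0; rewrite /r big_geq // sqrtr0 eqxx.
(* Here [r j = x j], so the angle is [acos 1] unless the default already applies. *)
- move=> j jn xj_ge0 tail0; rewrite /theta r_tail // ger0_norm //.
  by case: eqVneq => // xj0; rewrite divff // acos1.
Qed.

(** With at least two coordinates there is a last angle, [theta n], to absorb the sign of the last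
    coordinate; it alone may exceed [pi]. *)
Lemma hyperspherical_angles (R : realType) (n : nat) (x : nat -> R) :
    \sum_(0 <= i < n.+2) x i ^+ 2 = 1 ->
  exists theta : nat -> R,
    [/\ forall j, (j <= n)%N -> x j = cos (theta j) * \prod_(k < j) sin (theta k),
        x n.+1 = \prod_(k < n.+1) sin (theta k),
        forall j, (j < n)%N -> 0 <= theta j <= pi
      & 0 <= theta n <= 2 * pi].
Proof.
move=> x_norm; have pi_ge := @pi_ge0 R.
have [xn|xn] := leP 0 (x n.+1).
  have [theta [xE xnE rng _]] := hyperspherical_angles_pos x_norm xn.
  exists theta; split=> //.
  by have /andP[-> le_pi] := rng n; lra.
pose y j := if j == n.+1 then - x j else x j.
have y_norm : \sum_(0 <= i < n.+2) y i ^+ 2 = 1.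
  by rewrite -x_norm; apply: eq_bigr => i _; rewrite /y; case: ifP; rewrite ?sqrrN.
have [|theta [yE ynE rng _]] := hyperspherical_angles_pos y_norm.
  by rewrite /y eqxx oppr_ge0 ltW.
(* Reflecting the last angle flips the sign of the last coordinate only. *)
pose phi j := if j == n then pi *+ 2 - theta j else theta j.
have phiE j : (j < n)%N -> phi j = theta j by rewrite /phi ltn_neqAle => /andP[/negPf ->].
have prodE j : (j <= n)%N -> \prod_(k < j) sin (phi k) = \prod_(k < j) sin (theta k).
  by move=> jn; apply: eq_bigr => k _; rewrite phiE // (leq_trans (ltn_ord k)).
exists phi; split.
- move=> j jn; rewrite prodE //.
  have -> : cos (phi j) = cos (theta j).
    by rewrite /phi; case: ifP => // _; rewrite cosB cos2pi sin2pi mul1r mul0r addr0.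
  by rewrite -yE // /y ltn_eqF.
- rewrite big_ord_recr /= prodE // /phi eqxx sinB sin2pi cos2pi mul0r mul1r sub0r.
  by move: ynE; rewrite mulrN /y eqxx big_ord_recr => <-; rewrite opprK.
- by move=> j jn; rewrite phiE.
- by rewrite /phi eqxx mulr2n; have /andP[? ?] := rng n; apply/andP; split; lra.
Qed.

Lemma hyperspherical_ofnat (R : realType) (n : nat) (x : 'cV[R]_n.+2) (theta : nat -> R) :
    (forall j, (j <= n)%N -> x (inord j) 0 = cos (theta j) * \prod_(k < j) sin (theta k)) ->
    x (inord n.+1) 0 = \prod_(k < n.+1) sin (theta k) ->
  hyperspherical (fun j : 'I_n.+2.-1 => theta j) x.
Proof.
move=> xE xnE; split=> [j|i [ni]] /=.
  have jn : (j <= n)%N by rewrite -ltnS.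
  rewrite -(big_ord_widen n.+1 (fun k => sin (theta k)) (ltnW (ltn_ord j))) -xE //.
  by congr (x _ 0); apply: val_inj; rewrite /= inordK // ltnS ltnW.
by rewrite -xnE; congr (x _ 0); apply: val_inj; rewrite /= inordK.
Qed.

Theorem proposition1 (R : realType) (a1 l1 : nat)
    (hl : (1 <= l1)%N) (hla : (l1 <= a1)%N)
    (z : latent_param R a1 l1)
    (z_rank : \rank (leading_matrix hla z) = l1)
    (z_norm : forall v : 'I_a1, norm2 (z v) = 1) :
  (exists! w : latent_param R a1 l1,
      lower_triangular_pos hla w /\
      equivalent_under (@linear_kernel R l1) z w) /\
  ((2 <= l1)%N ->
   forall w : latent_param R a1 l1,
     lower_triangular_pos hla w ->
     equivalent_under (@linear_kernel R l1) z w ->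
     exists theta : 'I_a1 -> 'I_l1.-1 -> R,
       (forall v : 'I_a1, hyperspherical (theta v) (w v)) /\
       angle_constraints theta).
Proof.
split.
  have [w [w_tri zw]] : exists w : latent_param R a1 l1,
      lower_triangular_pos hla w /\ equivalent_under (@linear_kernel R l1) z w.
    by apply: triangular_param_exists; rewrite -row_free_unit /row_free z_rank.
  exists w; split=> // w' [w'_tri zw'].
  by apply: (triangular_param_unique w_tri w'_tri) => v v'; rewrite -zw zw'.
case: l1 hl hla z z_rank z_norm => [|[|n]] // _ hla z _ z_norm _ w [w0 w_gt0] zw.
(* Equivalence at a pair of equal levels transfers the unit norms from [z] to [w]. *)
have w_norm v : \sum_(0 <= i < n.+2) w v (inord i) 0 ^+ 2 = 1.
  transitivity (linear_kernel (w v) (w v)).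
    rewrite linear_kernelE big_mkord; apply: eq_bigr => i _.
    by rewrite inord_val.
  rewrite -zw linear_kernelE; have := z_norm v; rewrite /norm2 => /(congr1 (fun t => t ^+ 2)).
  by rewrite sqr_sqrtr ?expr1n // sumr_ge0 // => i _; rewrite sqr_ge0.
have anglesP v : exists theta : nat -> R,
    hyperspherical (fun j : 'I_n.+2.-1 => theta j) (w v) /\
    [/\ (n < v)%N -> 0 <= theta n <= 2 * pi,
        forall j, (j <= n)%N -> ((v <= n) || (j < n))%N -> 0 <= theta j <= pi
      & forall j, (v <= j <= n)%N -> theta j = 0].
  (* For [v > n] the last coordinate may be negative, but no angle is forced to be 0. For [v <= n]
     the last coordinate is 0, so the nonnegative case applies and supplies the zero angles. *)
  have [nv|vn] := ltnP n v.
    have [theta [wE wnE rng rngn]] := hyperspherical_angles (w_norm v).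
    exists theta; split; first exact: hyperspherical_ofnat.
    split=> // j; first by move=> _ /rng.
    by move=> /andP[vj jn]; move: (leq_trans (leq_trans nv vj) jn); rewrite ltnn.
  have tail0 i : (v < i <= n.+1)%N -> w v (inord i) 0 = 0.
    by move=> /andP[vi i_n]; rewrite w0 // inordK.
  have [|theta [wE wnE rng zeros]] := hyperspherical_angles_pos (w_norm v).
    by rewrite tail0 // ltnS vn /=.
  exists theta; split; first exact: hyperspherical_ofnat.
  split=> // j /andP[vj jn]; apply: zeros; first exact: leqW.
  (* For [j = v] the coordinate is a positive diagonal entry; for [j > v] it is 0. *)
  - move: vj; rewrite leq_eqVlt => /predU1P[<-|vj]; last by rewrite tail0 // vj leqW.
    have := w_gt0 (inord v); have -> : widen_ord hla (inord v) = v.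
      by apply: val_inj; rewrite /= inordK // ltnS leqW.
    exact: ltW.
  - by move=> i /andP[ji i_n]; rewrite tail0 // (leq_ltn_trans vj).
have [theta thetaP] := boolp.choice anglesP.
exists (fun v j => theta v j); split=> [v|v j]; first by have [] := thetaP v.
have [_ [rngn rng zeros]] := thetaP v.
have jn : (j <= n)%N by rewrite -ltnS.
split=> /=.
- by rewrite ltnS => nv [->]; exact: rngn.
- move=> _ vj; apply: rng => //; apply/orP.
  have [?|?] := leqP v n; [by left|right].
  by rewrite ltn_neqAle jn andbT; apply/eqP => jE; apply: vj; rewrite jE.
- by rewrite ltnS => vj; rewrite zeros // vj.
Qed.
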